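(* Let $\phi:\mathcal X\times\mathcal Y\to\mathbb R^d$ be a measurable embedding and let $r(x,y)=g(\phi(x,y))$ be any reward built on $\phi$, with $g:\mathbb R^d\to\mathbb R$ measurable. Then $$\mathcal L(r)-\mathcal L^\ast=\mathcal E_{\mathrm{emb}}(\phi)+\mathcal E_{\mathrm{agr}}(\phi,r),$$ where $$\mathcal E_{\mathrm{emb}}(\phi)=\mathbb E_{x\sim\nu}\mathbb E_{(y,y')\sim\mu_x^{\otimes2}}\bigl[D_{\mathrm{KL}}(\bar p(x,y,y')\,\|\,\tilde p_\phi(x,y,y'))\bigr],$$ $$\mathcal E_{\mathrm{agr}}(\phi,r)=\mathbb E_{x\sim\nu}\mathbb E_{(y,y')\sim\mu_x^{\otimes2}}\bigl[D_{\mathrm{KL}}(\tilde p_\phi(x,y,y')\,\|\,F(\Delta r(x,y,y')))\bigr].$$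
   Context: $\mathcal X$ (prompts) and $\mathcal Y$ (responses) are measurable spaces, $\nu$ is a probability measure on $\mathcal X$, and for each $x$, $\mu_x$ is a probability measure on $\mathcal Y$ (a probability kernel in $x$). There are $n\ge1$ annotators with measurable utilities $u_i:\mathcal X\times\mathcal Y\to\mathbb R$. Let $F(t)=1/(1+e^{-t})$ and let the pooled win probability be $\bar p(x,y,y')=\frac1n\sum_{i=1}^nF(u_i(x,y)-u_i(x,y'))$. For $p,q\in(0,1)$, $D_{\mathrm{KL}}(p\|q)=p\log\frac pq+(1-p)\log\frac{1-p}{1-q}$ is the KL divergence between Bernoulli distributions. Embedding-induced win probability: $\tilde p_\phi(x,y,y')=\mathbb E_{(y_0,y_0')\sim\mu_x^{\otimes2}}[\bar p(x,y_0,y_0')\mid\phi(x,y_0)=\phi(x,y),\ \phi(x,y_0')=\phi(x,y')]$, i.e. for each $x$ the conditional expectation of $\bar p(x,\cdot,\cdot)$ under $\mu_x^{\otimes 2}$ given the pair of embedded values. For a reward $r:\mathcal X\times\mathcal Y\to\mathbb R$, $\Delta r(x,y,y')=r(x,y)-r(x,y')$ and $$\mathcal L(r)=\mathbb E_{x\sim\nu}\mathbb E_{(y,y')\sim\mu_x^{\otimes2}}\bigl[-\bar p\log F(\Delta r)-(1-\bar p)\log(1-F(\Delta r))\bigr].$$ $\mathcal L^\ast$ is the Bayes-optimal loss, attained when the predicted probability equals $\bar p$ pointwise: $\mathcal L^\ast=\mathbb E_{x\sim\nu}\mathbb E_{(y,y')\sim\mu_x^{\otimes2}}[H(\bar p(x,y,y'))]$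 with $H(p)=-p\log p-(1-p)\log(1-p)$. *)

(* Defs.v *)
From HB Require Import structures.
From mathcomp Require Import all_boot all_order all_algebra.
From mathcomp Require Import all_classical all_reals all_analysis.
From mathcomp Require Import measurable_realfun.
Set Implicit Arguments.
Unset Strict Implicit.
Unset Printing Implicit Defensive.
Import Order.TTheory GRing.Theory Num.Theory.
Import numFieldNormedType.Exports.
Local Open Scope classical_set_scope.
Local Open Scope ring_scope.

Section Bernoulli.
Context {R : realType}.
Implicit Types p q t : R.

Definition logistic t : R := (1 + expR (- t))^-1.

Definition entropy p : R := - p * ln p - (1 - p) * ln (1 - p).

Definition cross_entropy p q : R := - p * ln q - (1 - p) * ln (1 - q).

(* Meant for [p] and [q] in ]0, 1[; outside, [ln] is the total logarithm, with
   [ln t = 0] for [t <= 0]. *)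
Definition kl_div p q : R := p * ln (p / q) + (1 - p) * ln ((1 - p) / (1 - q)).

End Bernoulli.

(* [h] is a version of the conditional expectation of [f] given [Z] under [P],
   that is, given the sigma-algebra of the preimages by [Z] of measurable
   sets. *)
Definition is_cond_exp {d d' : measure_display} {T : measurableType d}
    {T' : measurableType d'} {R : realType} (P : set T -> \bar R)
    (Z : T -> T') (f h : T -> R) : Prop :=
  let sigmaZ := preimage_set_system [set: T] Z measurable in
  [/\ P.-integrable [set: T] (EFin \o h),
      forall B : set R, measurable B -> sigmaZ (h @^-1` B) &
      forall A : set T, sigmaZ A ->
        (\int[P]_(w in A) (h w)%:E = \int[P]_(w in A) (f w)%:E)%E].

Section Preferences.
Context {dX dY : measure_display} {X : measurableType dX}
  {Y : measurableType dY} {R : realType}.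

Definition pooled_win_prob (n : nat) (u : 'I_n -> X * Y -> R)
    (x : X) (y y' : Y) : R :=
  n%:R^-1 * \sum_(i < n) logistic (u i (x, y) - u i (x, y')).

Definition reward_diff (r : X * Y -> R) (x : X) (y y' : Y) : R :=
  r (x, y) - r (x, y').

Variables (nu : probability X R) (mu : R.-pker X ~> Y).

Definition pair_expectation (f : X -> Y -> Y -> R) : \bar R :=
  (\int[nu]_x \int[mu x \x mu x]_z (f x z.1 z.2)%:E)%E.

Definition loss (pbar : X -> Y -> Y -> R) (r : X * Y -> R) : \bar R :=
  pair_expectation (fun x y y' =>
    cross_entropy (pbar x y y') (logistic (reward_diff r x y y'))).

Definition bayes_loss (pbar : X -> Y -> Y -> R) : \bar R :=
  pair_expectation (fun x y y' => entropy (pbar x y y')).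

(* The conditional expectation is determined only up to a null set for each
   prompt, so this is a predicate on its versions [ptilde]. A version of the
   conditional expectation of [pbar x] lies in ]0, 1[ almost surely when
   [pbar x] does. The space R^d is [d.-tuple R] with its product (Borel)
   sigma-algebra. *)
Definition is_embedded_win_prob (d : nat) (phi : X * Y -> d.-tuple R)
    (pbar ptilde : X -> Y -> Y -> R) : Prop :=
  forall x, is_cond_exp (mu x \x mu x)%E
    (fun z : Y * Y => (phi (x, z.1), phi (x, z.2)))
    (fun z => pbar x z.1 z.2) (fun z => ptilde x z.1 z.2).

Definition embedding_error (pbar ptilde : X -> Y -> Y -> R) : \bar R :=
  pair_expectation (fun x y y' => kl_div (pbar x y y') (ptilde x y y')).

Definition aggregation_error (ptilde : X -> Y -> Y -> R) (r : X * Y -> R)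
    : \bar R :=
  pair_expectation (fun x y y' =>
    kl_div (ptilde x y y') (logistic (reward_diff r x y y'))).

End Preferences.

(* Main.v *)
Require Import Defs.
From HB Require Import structures.
From mathcomp Require Import all_boot all_order all_algebra.
From mathcomp Require Import all_classical all_reals all_analysis.
From mathcomp Require Import measurable_realfun.
From mathcomp Require Import ring lra.
Set Implicit Arguments.
Unset Strict Implicit.
Unset Printing Implicit Defensive.
Import Order.TTheory GRing.Theory Num.Theory.
Import numFieldNormedType.Exports.
Local Open Scope classical_set_scope.
Local Open Scope ring_scope.

(* For a fixed prompt x, write f for the pooled win probability, h for its
conditional expectation and q = F(Delta r), which is a function of the embedded
pair. The cross entropy CE(p, q) = H(p) + KL(p || q) is affine in p, so f may be
replaced by h under the integral whenever the second argument is a function of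
the embedded pair: with second argument q this gives E CE(f, q) = E H(h) +
E KL(h || q), and with second argument h it gives E H(h) = E H(f) + E KL(f || h).

Adding these identities over x requires each term to be measurable in x,
although h is only given separately for each x. By the first identity,
E H(h) is the infimum of E CE(f, q) over any family of functions q of the
embedded pair that is rich enough to approximate h; the Borel sigma-algebra of
the embedding space being countably generated, a countable family, not depending
on x, suffices, and each E CE(f, q) is measurable in x by Fubini. *)

(** * Inequalities between Bernoulli entropy, cross entropy and divergence *)

Section bernoulli.
Context {R : realType}.
Implicit Types p q t e : R.

Lemma logistic_gt0 t : 0 < logistic t.
Proof. by rewrite invr_gt0 ltr_wpDr// expR_ge0. Qed.

Lemma logistic_lt1 t : logistic t < 1.
Proof. by rewrite invf_lt1 ?ltrDl ?expR_gt0// ltr_wpDr// expR_ge0. Qed.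

Lemma cross_entropyE p q : 0 < p < 1 -> 0 < q < 1 ->
  cross_entropy p q = entropy p + kl_div p q.
Proof.
move=> /andP[p0 p1] /andP[q0 q1]; rewrite /cross_entropy /entropy /kl_div.
by rewrite !ln_div ?posrE ?subr_gt0//; ring.
Qed.

Lemma cross_entropy_ge0 p q : 0 < p < 1 -> 0 < q < 1 -> 0 <= cross_entropy p q.
Proof.
move=> /andP[p0 p1] /andP[q0 q1]; rewrite /cross_entropy.
have : ln q <= 0 by rewrite ln_le0// ltW.
have : ln (1 - q) <= 0 by rewrite ln_le0// gerBl ltW.
nra.
Qed.

Lemma entropy_ge0 p : 0 < p < 1 -> 0 <= entropy p.
Proof. by move=> p01; exact: cross_entropy_ge0. Qed.

Lemma ln_leB1 t : 0 < t -> ln t <= t - 1.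
Proof.
move=> t0; have := @le_ln1Dx R (t - 1); rewrite addrCA subrr addr0; apply.
by rewrite ltrBrDl subrr.
Qed.

(** Applying [ln t <= t - 1] to [q / p] and to [(1 - q) / (1 - p)] bounds the two negated terms by
    [q - p] and [p - q], which cancel. *)
Lemma kl_div_ge0 p q : 0 < p < 1 -> 0 < q < 1 -> 0 <= kl_div p q.
Proof.
move=> /andP[p0 p1] /andP[q0 q1]; rewrite /kl_div.
have p1' : 0 < 1 - p by rewrite subr_gt0.
have q1' : 0 < 1 - q by rewrite subr_gt0.
rewrite -[p / q]invf_div -[_ / (1 - q)]invf_div !lnV ?posrE ?divr_gt0//.
have : p * ln (q / p) <= q - p.
  rewrite -[leRHS](_ : p * (q / p - 1) = _); last by field; rewrite gt_eqF.
  by rewrite ler_pM2l// ln_leB1// divr_gt0.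
have : (1 - p) * ln ((1 - q) / (1 - p)) <= p - q.
  rewrite -[leRHS](_ : (1 - p) * ((1 - q) / (1 - p) - 1) = _); last first.
    by field; rewrite gt_eqF.
  by rewrite ler_pM2l// ln_leB1// divr_gt0.
lra.
Qed.

(** Cross entropy against the fair coin is constantly [ln 2], and it exceeds the entropy by a
    nonnegative divergence. This uniform bound later makes the entropy integrals finite. *)
Lemma entropy_le_ln2 p : 0 < p < 1 -> entropy p <= ln 2.
Proof.
move=> p01; have h01 : 0 < (2^-1 : R) < 1 by apply/andP; split; lra.
rewrite -(_ : cross_entropy p 2^-1 = ln 2).
  by rewrite cross_entropyE// lerDl kl_div_ge0.
rewrite /cross_entropy (_ : 1 - 2^-1 = 2^-1 :> R); last by field.
by rewrite lnV ?posrE//; ring.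
Qed.

(** The inequality [ln t <= t - 1], now used at [p / q] and [(1 - p) / (1 - q)], bounds the
    divergence by the chi-square distance. *)
Lemma kl_div_le_chi2 p q : 0 < p < 1 -> 0 < q < 1 ->
  kl_div p q <= (p - q) ^+ 2 / (q * (1 - q)).
Proof.
move=> /andP[p0 p1] /andP[q0 q1]; rewrite /kl_div.
have p1' : 0 < 1 - p by rewrite subr_gt0.
have q1' : 0 < 1 - q by rewrite subr_gt0.
rewrite [leRHS](_ : _ = p * (p / q - 1) + (1 - p) * ((1 - p) / (1 - q) - 1)).
  by rewrite lerD// ler_pM2l// ln_leB1// divr_gt0.
by field; rewrite !gt_eqF.
Qed.

(** For [e <= 1 / 2], the projection onto the interval [e, 1 - e]: it keeps a predictor away from 0
    and 1, where the chi-square bound degenerates. *)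
Definition clip e q : R := Num.max e (Num.min (1 - e) q).

Lemma clip_itv e q : 0 < e <= 2^-1 -> e <= clip e q <= 1 - e.
Proof.
move=> /andP[e0 e2]; rewrite /clip le_max lexx/= ge_max ge_min lexx/= andbT.
lra.
Qed.

(* The clipped [c] satisfies [c (1 - c) >= e / 2] and
   [`|p - c| <= max e `|p - q|], to be used in the chi-square bound. *)
Lemma kl_div_clip_le e p q : 0 < e <= 2^-1 -> 0 < p < 1 ->
  kl_div p (clip e q) <= 2 * e + 2 / e * `|p - q|.
Proof.
move=> e2 p01; have /andP[ec c1e] := clip_itv q e2.
move: (e2) (p01) => /andP[e0 e2'] /andP[p0 p1].
have c01 : 0 < clip e q < 1 by apply/andP; split; lra.
apply: (le_trans (kl_div_le_chi2 p01 c01)).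
set c := clip e q in ec c1e c01 *.
have cc : e / 2 <= c * (1 - c) by nra.
have cc0 : 0 < c * (1 - c) by nra.
have pc : `|p - c| <= Num.max e `|p - q|.
  rewrite le_max /c /clip maxEle minEle.
  case: (leP (1 - e) q) => [qe|qe].
    case: ifPn => [_|]; last by rewrite -ltNge; lra.
    have [pe|pe] := leP p (1 - e); last by rewrite ger0_norm; lra.
    by rewrite !ler0_norm; lra.
  case: (leP e q) => [eq|eq]; first by rewrite lexx orbT.
  have [pe|pe] := leP e p; last by rewrite ltr0_norm; lra.
  by rewrite !ger0_norm; lra.
have pc1 : `|p - c| <= 1 by rewrite ler_norml; lra.
have pc0 := normr_ge0 (p - c); have pq0 := normr_ge0 (p - q).
rewrite -real_normK ?num_real// ler_pdivrMr//.
set a := `|p - c| in pc pc1 pc0 *; set b := `|p - q| in pc pq0 *.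
apply: (@le_trans _ _ ((2 * e + 2 / e * b) * (e / 2))); last first.
  rewrite ler_wpM2l// addr_ge0// ?mulr_ge0// ?invr_ge0; lra.
rewrite [leRHS](_ : _ = e ^+ 2 + b); last by field; rewrite gt_eqF.
(* If [a <= e], then [a ^+ 2 <= e ^+ 2]; if [a <= b], then [a ^+ 2 <= a <= b] because [a <= 1]. *)
move: pc; rewrite le_max => /orP[]; nra.
Qed.

End bernoulli.

(** * Measurability in the prompt of integrals over response pairs *)

Section pair_kernel.
Context {dX dY : measure_display} {X : measurableType dX}
  {Y : measurableType dY} {R : realType} (mu : R.-pker X ~> Y).

(* [mu x] carries no canonical probability structure, hence this alias; as
   functions on sets, [pair_prob x] and [mu x \x mu x] are convertible. *)
Definition response_prob (x : X) : set Y -> \bar R := mu x.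

HB.instance Definition _ x := Measure.on (response_prob x).

HB.instance Definition _ x :=
  Measure_isProbability.Build _ _ _ (response_prob x) (prob_kernel x).

Definition pair_prob (x : X) : probability (Y * Y)%type R :=
  (response_prob x \x response_prob x)%E.

(** The kernel [mu] with the first response as an ignored extra parameter: the inner integral of an
    iterated integral becomes one against a kernel on [X * Y]. *)
Definition fst_kernel (p : X * Y) : {measure set Y -> \bar R} := mu p.1.

Let measurable_fst_kernel (U : set Y) :
  measurable U -> measurable_fun [set: X * Y] (fst_kernel ^~ U).
Proof.
move=> mU; exact: (measurableT_comp (measurable_kernel mu U mU) measurable_fst).
Qed.

HB.instance Definition _ :=
  isKernel.Build _ _ _ _ R fst_kernel measurable_fst_kernel.

Let fst_kernel_prob p : fst_kernel p [set: Y] = 1%E.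
Proof. exact: prob_kernel. Qed.

HB.instance Definition _ :=
  Kernel_isProbability.Build _ _ _ _ R fst_kernel fst_kernel_prob.

(** Tonelli splits the product integral into two successive ones, against [fst_kernel] and then
    against [mu]; integrating a nonnegative function against a finite kernel preserves measurability
    in the parameter. *)
Lemma measurable_pair_integral (F : X * (Y * Y) -> \bar R) :
  (forall w, (0 <= F w)%E) -> measurable_fun setT F ->
  measurable_fun [set: X] (fun x => \int[pair_prob x]_z F (x, z))%E.
Proof.
move=> F0 mF.
rewrite (_ : (fun x => _) = fun x =>
    (\int[mu x]_y \int[fst_kernel (x, y)]_y' F (x, (y, y')))%E); last first.
  apply/funext => x; rewrite fubini_tonelli1//.
  exact: (measurable_fun_pair2 x mF).
apply: (@measurable_fun_integral_finite_kernel _ _ _ _ _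
  (fun p => \int[fst_kernel p]_y F (p.1, (p.2, y)))%E mu).
  by move=> p; apply: integral_ge0.
apply: (@measurable_fun_integral_finite_kernel _ _ _ _ _
  (fun p => F (p.1.1, (p.1.2, p.2))) fst_kernel) => //.
apply: (measurableT_comp mF); apply/measurable_fun_pair.
  exact: measurableT_comp.
by apply/measurable_fun_pair => //; exact: measurableT_comp.
Qed.

End pair_kernel.

(** * Measurability of the Bernoulli quantities *)

Section measurability.
Context {R : realType}.

Lemma measurable_inv : measurable_fun [set: R] (@GRing.inv R).
Proof.
(* Also valid at [0], as [0^-1 = 0]. *)
rewrite (_ : @GRing.inv R = fun t => t * (`|t| `^ (- 1)) ^+ 2); last first.
  apply/funext => t; rewrite powR_inv1// exprVn real_normK ?num_real//.
  by have [->|t0] := eqVneq t 0; rewrite ?invr0 ?mul0r//; field.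
apply: measurable_funM => //; apply: measurable_funX.
exact: (measurableT_comp (measurable_powR _) (@normr_measurable R setT)).
Qed.

Context {d : measure_display} {T : measurableType d}.
Implicit Types p q : T -> R.

Lemma measurable_kl_div p q : measurable_fun setT p -> measurable_fun setT q ->
  measurable_fun setT (fun z => kl_div (p z) (q z)).
Proof.
move=> mp mq; apply: measurable_funD; apply: measurable_funM => //.
- apply: (measurableT_comp (@measurable_ln R)); apply: measurable_funM => //.
  exact: (measurableT_comp measurable_inv).
- exact: measurable_funB.
- apply: (measurableT_comp (@measurable_ln R)); apply: measurable_funM.
    exact: measurable_funB.
  by apply: (measurableT_comp measurable_inv); exact: measurable_funB.
Qed.

Lemma measurable_cross_entropy p q :
  measurable_fun setT p -> measurable_fun setT q ->
  measurable_fun setT (fun z => cross_entropy (p z) (q z)).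
Proof.
move=> mp mq; apply: measurable_funB; apply: measurable_funM => //.
- exact: measurable_funN.
- exact: (measurableT_comp (@measurable_ln R)).
- exact: measurable_funB.
- by apply: (measurableT_comp (@measurable_ln R)); exact: measurable_funB.
Qed.

Lemma measurable_entropy p : measurable_fun setT p ->
  measurable_fun setT (fun z => entropy (p z)).
Proof. by move=> mp; exact: measurable_cross_entropy. Qed.

Lemma measurable_logistic p : measurable_fun setT p ->
  measurable_fun setT (fun z => logistic (p z)).
Proof.
move=> mp; apply: (measurableT_comp measurable_inv).
apply: measurable_funD => //; apply: (measurableT_comp (@measurable_expR R)).
exact: measurable_funN.
Qed.

Lemma measurable_clip e p : measurable_fun setT p ->
  measurable_fun setT (fun z => clip e (p z)).
Proof.
by move=> mp; apply: measurable_maxr => //; exact: measurable_minr.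
Qed.

Lemma integral_cross_entropyE (P : {measure set T -> \bar R}) p q :
  measurable_fun setT p -> measurable_fun setT q ->
  (forall z, 0 < p z < 1) -> (forall z, 0 < q z < 1) ->
  (\int[P]_z (cross_entropy (p z) (q z))%:E =
   \int[P]_z (entropy (p z))%:E + \int[P]_z (kl_div (p z) (q z))%:E)%E.
Proof.
move=> mp mq p01 q01; rewrite -ge0_integralD//.
- by apply: eq_integral => z _; rewrite cross_entropyE.
- by move=> z _; rewrite lee_fin entropy_ge0.
- by apply/measurable_EFinP; exact: measurable_entropy.
- by move=> z _; rewrite lee_fin kl_div_ge0.
- by apply/measurable_EFinP; exact: measurable_kl_div.
Qed.

End measurability.

(** * Conditional expectation of nonnegative functions given [Z] *)

Section cond_exp.
Context {d d' : measure_display} {T : measurableType d} {W : measurableType d'}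
  {R : realType} (P : {measure set T -> \bar R}) (Z : T -> W).
Hypothesis mZ : measurable_fun setT Z.

(** The set [T] with the sigma-algebra of preimages by [Z]; measurability on [TZ] expresses being a
    function of [Z]. *)
Local Notation TZ := (g_sigma_algebra_preimageType Z).

Lemma measurable_preimageW (A : set T) :
  measurable (A : set TZ) -> measurable A.
Proof. by case=> B mB <-; exact: mZ. Qed.

Lemma measurable_fun_preimageW d2 (U : measurableType d2) (w : TZ -> U) :
  measurable_fun setT w -> measurable_fun [set: T] w.
Proof.
move=> mw _ B mB; apply: measurable_preimageW; exact: mw.
Qed.

Lemma measurable_fun_preimage_comp d2 (U : measurableType d2) (k : W -> U) :
  measurable_fun setT k -> measurable_fun [set: TZ] (k \o Z).
Proof.
move=> mk _ B mB; exists (k @^-1` B); last by rewrite !setTI.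
by rewrite -[X in measurable X]setTI; exact: mk.
Qed.

Import HBNNSimple.

(** The pull-out property, with nonnegativity in place of integrability. The weight [w] is
    approximated from below by simple functions on [TZ]; their level sets belong to the preimage
    sigma-algebra, on which [h] and [f] have equal integrals. *)
Lemma cond_exp_mule (f h : T -> R) (w : TZ -> \bar R) :
  measurable_fun setT f -> measurable_fun [set: T] h ->
  (forall z, 0 <= f z) -> (forall z, 0 <= h z) ->
  (forall A : set T, measurable (A : set TZ) ->
    \int[P]_(z in A) (h z)%:E = \int[P]_(z in A) (f z)%:E)%E ->
  measurable_fun setT w -> (forall z, (0 <= w z)%E) ->
  (\int[P]_z ((h z)%:E * w z) = \int[P]_z ((f z)%:E * w z))%E.
Proof.
move=> mf mh f0 h0 fh mw w0.
pose s := nnsfun_approx (@measurableT _ TZ) mw.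
have ms n : measurable_fun [set: T] (s n : T -> R).
  by apply: measurable_fun_preimageW; exact/measurable_funP.
have msZ n r : measurable (s n @^-1` [set r] : set TZ).
  by rewrite -[X in measurable X]setTI; exact: measurable_funP.
have msI n r : measurable (s n @^-1` [set r] : set T).
  exact: measurable_preimageW (msZ n r).
(* On the right-hand side [k] occurs only through its integrals over level sets of [s n], so the
   value is the same for [h] and [f]. *)
suff lims (k : T -> R) : measurable_fun [set: T] k -> (forall z, 0 <= k z) ->
    (\int[P]_z ((k z)%:E * w z) = limn (fun n => \sum_(r \in range (s n))
        (r%:E * \int[P]_(z in s n @^-1` [set r]) (k z)%:E)))%E.
  rewrite !lims//; congr (limn _); apply/funext => n; apply: eq_fsbigr => r _.
  by rewrite fh//; exact: msZ.
move=> {f h mf mh f0 h0 fh} mk k0.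
transitivity (limn (fun n => \int[P]_z ((k z)%:E * (s n z)%:E))%E).
  rewrite -monotone_convergence//.
  - apply: eq_integral => z _; apply/esym/cvg_lim => //.
    by apply: cvgeZl => //; exact: cvg_nnsfun_approx.
  - by move=> n; apply/measurable_EFinP; exact: measurable_funM.
  - by move=> n z _; rewrite lee_fin mulr_ge0.
  - move=> z _ a b ab; rewrite lee_fin ler_wpM2l//.
    by have /lefP := @nd_nnsfun_approx _ _ _ _ measurableT _ mw _ _ ab; exact.
congr (limn _); apply/funext => n.
transitivity (\int[P]_z (\sum_(r \in range (s n))
    (r * (k z * \1_(s n @^-1` [set r]) z))%:E))%E.
  apply: eq_integral => z _; rewrite fimfunE -EFinM fsumEFin//; congr (_%:E).
  by rewrite mulr_fsumr; apply: eq_fsbigr => r _; rewrite mulrCA.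
rewrite ge0_integral_fsum//; last 2 first.
- move=> r; apply/measurable_EFinP; apply: measurable_funM => //.
  by apply: measurable_funM => //; exact: measurable_indic.
- move=> r z _; rewrite mulrCA EFinM; apply: mule_ge0; rewrite ?lee_fin//.
  by rewrite -lee_fin EFinM nnfun_muleindic_ge0.
apply: eq_fsbigr => r; rewrite inE => -[t _ <-].
under eq_integral do rewrite EFinM.
rewrite ge0_integralZl_EFin//; last 2 first.
- by move=> z _; rewrite lee_fin mulr_ge0.
- apply/measurable_EFinP; apply: measurable_funM => //; exact: measurable_indic.
congr (_ * _)%E; rewrite [RHS]integral_mkcond.
by apply: eq_integral => z _; rewrite EFinM epatch_indic.
Qed.

(** Positivity makes the integral of the absolute value of [f] over [D] vanish, so [f] would be zero
    almost everywhere on [D]. This serves to show that a conditional expectation lies in ]0, 1[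
    almost surely. *)
Lemma integral_le0_null (D : set T) (f : T -> R) : measurable D ->
  measurable_fun setT f -> (forall z, D z -> 0 < f z) ->
  (\int[P]_(z in D) (f z)%:E <= 0)%E -> P D = 0%E.
Proof.
move=> mD mf f0 If.
have mfD : measurable_fun D (EFin \o f).
  by apply/measurable_EFinP; exact: measurable_funTS.
have /(ae_eq_integral_abs _ mD mfD).1 : (\int[P]_(z in D) `|(f z)%:E| = 0)%E.
  apply/eqP; rewrite eq_le integral_ge0// andbT.
  rewrite (eq_integral (fun z => (f z)%:E))// => z; rewrite inE => Dz.
  by rewrite gee0_abs// lee_fin ltW// f0.
move=> [N [mN PN DN]]; apply/eqP; rewrite -measure_le0 -PN le_measure ?inE//.
move=> z Dz; apply: DN => /= /(_ Dz) [fz].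
by have := f0 z Dz; rewrite fz ltxx.
Qed.

End cond_exp.

(** * Conditional entropy identities for a fixed prompt *)

Section cond_entropy.
Context {d d' : measure_display} {T : measurableType d} {W : measurableType d'}
  {R : realType} (P : probability T R) (Z : T -> W).
Hypothesis mZ : measurable_fun setT Z.

Local Notation TZ := (g_sigma_algebra_preimageType Z).

Variable f : T -> R.
Hypotheses (mf : measurable_fun setT f) (f01 : forall z, 0 < f z < 1).

Lemma integrable_itv01 (k : T -> R) (A : set T) : measurable A ->
  measurable_fun setT k -> (forall z, 0 < k z < 1) ->
  P.-integrable A (EFin \o k).
Proof.
move=> mA mk k01; apply: measurable_bounded_integrable => //.
- by rewrite (le_lt_trans (probability_le1 P mA))// ltry.
- exact: measurable_funTS.
exists 1; split => // M M1 z _ /=; have /andP[k0 k1] := k01 z.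
by rewrite ger0_norm ?(ltW k0)// (le_trans (ltW k1))// ltW.
Qed.

Definition half_unless01 (t : R) : R := if 0 < t < 1 then t else 2^-1.

Lemma half_unless01_itv t : 0 < half_unless01 t < 1.
Proof. by rewrite /half_unless01; case: ifPn => // _; apply/andP; split; lra. Qed.

Lemma measurable_half_unless01 : measurable_fun setT half_unless01.
Proof.
apply: measurable_fun_ifT => //; apply: measurable_and;
  exact: measurable_fun_ltr.
Qed.

(** The sets [h <= 0] and [1 <= h] belong to the sigma-algebra of [Z]. The integral of [f] over the
    first equals that of [h], hence is at most 0 although [f] is positive; the same argument with
    [1 - f] treats the second. Both sets are therefore null, and resetting [h] to 1/2 there changes
    no integral. The clause on [psi] serves to transfer both divergence errors to the new
    version. *)
Lemma cond_exp_itv01 h : is_cond_exp P Z f h -> exists h' : TZ -> R,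
  [/\ measurable_fun setT h', forall z, 0 < h' z < 1,
      forall A : set T, measurable (A : set TZ) ->
        (\int[P]_(z in A) (h' z)%:E = \int[P]_(z in A) (f z)%:E)%E &
      forall psi : T -> R -> R,
        measurable_fun setT (fun p : T * R => psi p.1 p.2) ->
        (\int[P]_z (psi z (h z))%:E = \int[P]_z (psi z (h' z))%:E)%E].
Proof.
move=> [ih mh hf].
have mhZ : measurable_fun [set: TZ] h by move=> _ B mB; rewrite setTI; exact: mh.
have mhT : measurable_fun [set: T] h by exact: measurable_fun_preimageW mhZ.
exists (half_unless01 \o h).
have mh'Z : measurable_fun [set: TZ] (half_unless01 \o h).
  exact: (measurableT_comp measurable_half_unless01 mhZ).
have mh' : measurable_fun [set: T] (half_unless01 \o h).
  exact: measurable_fun_preimageW mh'Z.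
have Dle0 : P [set z | h z <= 0] = 0%E.
  have mDZ : measurable ([set z | h z <= 0] : set TZ).
    by rewrite -[X in measurable X]setTI; exact: measurable_fun_ler.
  have mDT := measurable_preimageW mZ mDZ.
  apply: (integral_le0_null mDT mf) => [z _|]; first by have /andP[] := f01 z.
  rewrite -hf// -(integral0 P [set z | h z <= 0]).
  apply: le_integral => //; [exact: integrableS ih|exact: integrable0|].
  by move=> z; rewrite inE.
have Dge1 : P [set z | 1 <= h z] = 0%E.
  have mDZ : measurable ([set z | 1 <= h z] : set TZ).
    by rewrite -[X in measurable X]setTI; exact: measurable_fun_ler.
  have mDT := measurable_preimageW mZ mDZ.
  have ihD := integrableS measurableT mDT (@subsetT _ _) ih.
  have i1 := finite_measure_integrable_cst P (1 : R) mDT.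
  apply: (integral_le0_null (f := fun z => 1 - f z) mDT).
  - exact: measurable_funB.
  - by move=> z _; rewrite subr_gt0; have /andP[] := f01 z.
  under eq_integral do rewrite EFinB.
  rewrite integralB_EFin//; last exact: integrable_itv01.
  rewrite -hf// -integralB_EFin// -(integral0 P [set z | 1 <= h z]).
  apply: le_integral => //.
  - exact: integrableB.
  - exact: integrable0.
  - by move=> z; rewrite inE => hz; rewrite -EFinB lee_fin subr_le0.
have h'E : ae_eq P setT h (half_unless01 \o h).
  have N0 : P.-negligible [set z | h z <= 0].
    exists [set z | h z <= 0]; split => //.
    by rewrite -[X in measurable X]setTI; exact: measurable_fun_ler.
  have N1 : P.-negligible [set z | 1 <= h z].
    exists [set z | 1 <= h z]; split => //.
    by rewrite -[X in measurable X]setTI; exact: measurable_fun_ler.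
  apply: negligibleS (negligibleU N0 N1) => z /= /not_implyP[_] h'z.
  apply/orP; rewrite leNgt [1 <= _]leNgt -negb_and; apply/negP => h01.
  by apply: h'z; rewrite /half_unless01 h01.
have ae psi A : measurable A ->
    measurable_fun setT (fun p : T * R => psi p.1 p.2) ->
    (\int[P]_(z in A) (psi z (h z))%:E =
     \int[P]_(z in A) (psi z (half_unless01 (h z)))%:E)%E.
  move=> mA mpsi; apply: ae_eq_integral => //.
  - apply/measurable_EFinP; apply: measurable_funTS.
    exact: (measurableT_comp mpsi (measurable_fun_pair (@measurable_id _ T setT) mhT)).
  - apply/measurable_EFinP; apply: measurable_funTS.
    exact: (measurableT_comp mpsi (measurable_fun_pair (@measurable_id _ T setT) mh')).
  - by apply: filterS h'E => z /= hz _; rewrite [in LHS]hz.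
split => //.
- by move=> z; exact: half_unless01_itv.
- move=> A mA; rewrite -hf//; apply/esym.
  exact: (ae (fun _ t => t) A (measurable_preimageW mZ mA) measurable_snd).
- by move=> psi mpsi; rewrite (ae psi).
Qed.

Variable h : TZ -> R.
Hypotheses (mh : measurable_fun setT h) (h01 : forall z, 0 < h z < 1).
Hypothesis hf : forall A : set T, measurable (A : set TZ) ->
  (\int[P]_(z in A) (h z)%:E = \int[P]_(z in A) (f z)%:E)%E.

(** Cross entropy is [- ln q] weighted by [f] plus [- ln (1 - q)] weighted by [1 - f]. Both
    logarithmic factors are nonnegative functions of [Z], so the pull-out property applies even if
    the integrals are infinite. *)
Lemma cond_cross_entropy (q : TZ -> R) : measurable_fun setT q ->
  (forall z, 0 < q z < 1) ->
  (\int[P]_z (cross_entropy (f z) (q z))%:E =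
   \int[P]_z (cross_entropy (h z) (q z))%:E)%E.
Proof.
move=> mq q01.
have lnq z : 0 <= - ln (q z).
  by rewrite oppr_ge0 ln_le0// ltW//; case/andP: (q01 z).
have ln1q z : 0 <= - ln (1 - q z).
  by rewrite oppr_ge0 ln_le0// gerBl ltW//; case/andP: (q01 z).
have mlnq : measurable_fun setT (fun z : TZ => - ln (q z)).
  by apply: measurable_funN; exact: (measurableT_comp (@measurable_ln R)).
have mln1q : measurable_fun setT (fun z : TZ => - ln (1 - q z)).
  apply: measurable_funN; apply: (measurableT_comp (@measurable_ln R)).
  exact: measurable_funB.
have split (k : T -> R) : measurable_fun setT k -> (forall z, 0 < k z < 1) ->
    (\int[P]_z (cross_entropy (k z) (q z))%:E =
     \int[P]_z ((k z)%:E * (- ln (q z))%:E) +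
     \int[P]_z ((1 - k z)%:E * (- ln (1 - q z))%:E))%E.
  move=> mk k01; rewrite -ge0_integralD//.
  - apply: eq_integral => z _; rewrite -!EFinM -EFinD; congr (_%:E).
    by rewrite /cross_entropy; ring.
  - by move=> z _; rewrite lee_fin mulr_ge0// ltW//; case/andP: (k01 z).
  - apply/measurable_EFinP; apply: measurable_funM => //.
    exact: measurable_fun_preimageW mlnq.
  - by move=> z _; rewrite lee_fin mulr_ge0// subr_ge0 ltW//; case/andP: (k01 z).
  - apply/measurable_EFinP; apply: measurable_funM; first exact: measurable_funB.
    exact: measurable_fun_preimageW mln1q.
have mhT : measurable_fun [set: T] h by exact: measurable_fun_preimageW mh.
rewrite !split//; congr (_ + _)%E; apply/esym.
- apply: (cond_exp_mule mZ) => //.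
  + by move=> z; case/andP: (f01 z) => /ltW.
  + by move=> z; case/andP: (h01 z) => /ltW.
  + exact/measurable_EFinP.
- apply: (cond_exp_mule mZ (f := fun z => 1 - f z) (h := fun z => 1 - h z)) => //.
  + exact: measurable_funB.
  + exact: measurable_funB.
  + by move=> z; rewrite subr_ge0; case/andP: (f01 z) => _ /ltW.
  + by move=> z; rewrite subr_ge0; case/andP: (h01 z) => _ /ltW.
  + move=> A mA; have mAT := measurable_preimageW mZ mA.
    have i1 := finite_measure_integrable_cst P (1 : R) mAT.
    under eq_integral do rewrite EFinB.
    under [RHS]eq_integral do rewrite EFinB.
    by rewrite !integralB_EFin ?hf//; exact: integrable_itv01.
  + exact/measurable_EFinP.
Qed.

Lemma cond_entropyE :
  (\int[P]_z (entropy (h z))%:E =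
   \int[P]_z (entropy (f z))%:E + \int[P]_z (kl_div (f z) (h z))%:E)%E.
Proof.
have mhT : measurable_fun [set: T] h by exact: measurable_fun_preimageW mh.
rewrite -integral_cross_entropyE//.
(* With second argument [h] itself, [cross_entropy (h z) (h z)] unfolds to [entropy (h z)]. *)
exact: (esym (cond_cross_entropy mh h01)).
Qed.

Lemma cond_cross_entropyE (q : TZ -> R) : measurable_fun setT q ->
  (forall z, 0 < q z < 1) ->
  (\int[P]_z (cross_entropy (f z) (q z))%:E =
   \int[P]_z (entropy (h z))%:E + \int[P]_z (kl_div (h z) (q z))%:E)%E.
Proof.
move=> mq q01; rewrite cond_cross_entropy// integral_cross_entropyE//.
- exact: measurable_fun_preimageW mh.
- exact: measurable_fun_preimageW mq.
Qed.

End cond_entropy.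

(** * Integer part as a sum of threshold indicators *)

Section count_steps.
Context {R : realType}.
Implicit Type t : R.

(** The sum counts the integers from 1 to [N] that are at most [t], so it is the integer part of
    [t]. Written this way, rounding a function yields a combination of indicators of superlevel
    sets. *)
Lemma count_steps_itv (N : nat) t : 0 <= t -> t <= N%:R ->
  \sum_(j < N) (j.+1%:R <= t)%R%:R <= t <= \sum_(j < N) (j.+1%:R <= t)%R%:R + 1.
Proof.
move=> t0; elim: N => [tN|N IH tN].
  by rewrite big_ord0 add0r; apply/andP; split; lra.
rewrite big_ord_recr/=; have SN : N.+1%:R = N%:R + 1 :> R by rewrite natr1.
have full : N%:R <= t -> \sum_(j < N) (j.+1%:R <= t)%R%:R = N%:R :> R.
  move=> Nt; transitivity (\sum_(j < N) (1 : R)); last by rewrite sumr_const card_ord.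
  by apply: eq_bigr => j _; rewrite (le_trans _ Nt)// ler_nat.
have [St|St] := leP N.+1%:R t.
  have NS : N%:R <= N.+1%:R :> R by rewrite ler_nat.
  by rewrite full ?(le_trans NS)//= mulr1n; lra.
rewrite addr0; have [/IH//|Nt] := leP t N%:R.
by rewrite full ?ltW//; lra.
Qed.

End count_steps.

(** * L1 density of a countable family of step functions *)

Section step_comb.
Context {I : countType} {d : measure_display} {W : measurableType d}
  {R : realType} (G : I -> set W).
Implicit Types (s : seq I) (c : seq (rat * seq I)).

(** Finite intersections of generators form a pi-system, which contains the full set through the
    empty list. *)
Definition gen_cap s : set W := \big[setI/setT]_(i <- s) G i.

(** Rational coefficients and finite lists of indices keep this family countable and independent of
    any measure. *)
Definition step_comb c (w : W) : R :=
  \sum_(a <- c) ratr a.1 * \1_(gen_cap a.2) w.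

Lemma step_comb_cat c1 c2 w :
  step_comb (c1 ++ c2) w = step_comb c1 w + step_comb c2 w.
Proof. exact: big_cat. Qed.

Lemma step_comb_scale (a : rat) c w :
  step_comb [seq (a * b.1, b.2) | b <- c] w = ratr a * step_comb c w.
Proof.
rewrite /step_comb big_map mulr_sumr; apply: eq_bigr => b _.
by rewrite rmorphM mulrA.
Qed.

Hypothesis mG : forall i, measurable (G i).

Lemma measurable_gen_cap s : measurable (gen_cap s).
Proof. exact: bigsetI_measurable. Qed.

Lemma measurable_step_comb c : measurable_fun setT (step_comb c).
Proof.
rewrite /step_comb; apply: measurable_sum => a; apply: measurable_funM => //.
by apply: measurable_indic; exact: measurable_gen_cap.
Qed.

Hypothesis WG : @measurable _ W `<=` <<s range G>>.

Context {d' : measure_display} {T : measurableType d'} (P : probability T R)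
  (Z : T -> W).
Hypothesis mZ : measurable_fun setT Z.

Local Notation TZ := (g_sigma_algebra_preimageType Z).

Local Notation dist k1 k2 := (\int[P]_z `|k1 z - k2 z|%:E)%E.

Let mdist (k1 k2 : T -> R) : measurable_fun setT k1 -> measurable_fun setT k2 ->
  measurable_fun setT (fun z => `|k1 z - k2 z|%:E).
Proof.
move=> m1 m2; apply/measurable_EFinP.
by apply: (measurableT_comp (@normr_measurable R setT)); exact: measurable_funB.
Qed.

Lemma dist_triangle (k2 k1 k3 : T -> R) : measurable_fun setT k1 ->
  measurable_fun setT k2 -> measurable_fun setT k3 ->
  (dist k1 k3 <= dist k1 k2 + dist k2 k3)%E.
Proof.
move=> m1 m2 m3; rewrite -ge0_integralD//; [|exact: mdist..].
apply: ge0_le_integral => //; first exact: mdist.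
  by apply: emeasurable_funD; exact: mdist.
by move=> z _; rewrite -EFinD lee_fin ler_distD.
Qed.

Let mcombZ c : measurable_fun setT (fun z => step_comb c (Z z)).
Proof. exact: (measurableT_comp (measurable_step_comb c) mZ). Qed.

Definition approximable (k : T -> R) := measurable_fun setT k /\
  forall e, 0 < e -> exists c, (dist k (fun z => step_comb c (Z z)) <= e%:E)%E.

Lemma approximable_close (k : T -> R) : measurable_fun setT k ->
  (forall e, 0 < e -> exists2 k', approximable k' & (dist k k' <= e%:E)%E) ->
  approximable k.
Proof.
move=> mk H; split => // e e0.
have e20 : 0 < e / 2 by rewrite divr_gt0.
have [k' [mk' k'a] kk'] := H _ e20.
have [c k'c] := k'a _ e20; exists c.
apply: (le_trans (dist_triangle mk mk' (mcombZ c))).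
by rewrite [e]splitr EFinD leeD.
Qed.

Lemma approximableD (k1 k2 : T -> R) : approximable k1 -> approximable k2 ->
  approximable (fun z => k1 z + k2 z).
Proof.
move=> [m1 a1] [m2 a2]; split => [|e e0]; first exact: measurable_funD.
have e20 : 0 < e / 2 by rewrite divr_gt0.
have [c1 k1c] := a1 _ e20; have [c2 k2c] := a2 _ e20.
exists (c1 ++ c2); rewrite [e]splitr EFinD.
apply: le_trans (leeD k1c k2c); rewrite -ge0_integralD//; [|exact: mdist..].
apply: ge0_le_integral => //.
- by apply: mdist => //; exact: measurable_funD.
- by apply: emeasurable_funD; exact: mdist.
move=> z _; rewrite -EFinD lee_fin step_comb_cat opprD addrACA.
exact: ler_normD.
Qed.

Lemma approximableZ (a : rat) (k : T -> R) : approximable k ->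
  approximable (fun z => ratr a * k z).
Proof.
move=> [mk ka]; split => [|e e0]; first exact: measurable_funM.
(* Adding 1 keeps the divisor positive when [a] is 0. *)
have a10 : 0 < `|ratr a : R| + 1 by rewrite ltr_wpDl.
have [c kc] := ka _ (divr_gt0 e0 a10).
exists [seq (a * b.1, b.2) | b <- c].
under eq_integral do rewrite step_comb_scale -mulrBr normrM EFinM.
rewrite ge0_integralZl_EFin//; last exact: mdist.
apply: (@le_trans _ _ (`|ratr a|%:E * (e / (`|ratr a| + 1))%:E)%E).
  by rewrite lee_wpmul2l// lee_fin.
rewrite -EFinM lee_fin mulrCA ger_pMr// ler_pdivrMr// mul1r.
by rewrite lerDl.
Qed.

Lemma approximable_cap s : approximable (fun z => \1_(gen_cap s) (Z z)).
Proof.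
split => [|e e0].
  by apply: (measurableT_comp _ mZ); exact: measurable_indic (measurable_gen_cap s).
exists [:: (1, s)]; under eq_integral => z _.
  rewrite /step_comb big_seq1/= rmorph1 mul1r subrr normr0; over.
by rewrite integral0 lee_fin ltW.
Qed.

(** Dynkin's pi-lambda theorem: the measurable sets whose indicator is approximable form a
    lambda-system containing the pi-system of finite intersections of generators. *)
Lemma approximable_indic (B : set W) : measurable B ->
  approximable (fun z => \1_B (Z z)).
Proof.
move=> mB.
suff H : <<s setT, range gen_cap >> `<=`
    [set B | measurable B /\ approximable (fun z => \1_B (Z z))].
  have /H[] // : <<s range gen_cap >> B.
  apply: sub_smallest2r (WG mB); first exact: smallest_sigma_algebra.
  by move=> _ [i _ <-]; exists [:: i] => //; rewrite /gen_cap big_seq1.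
have mI C : measurable C -> measurable_fun [set: T] (fun z => \1_C (Z z) : R).
  by move=> mC; apply: (measurableT_comp _ mZ); exact: measurable_indic.
apply: lambda_system_subset => //.
- move=> _ _ [s1 _ <-] [s2 _ <-]; exists (s1 ++ s2) => //.
  by rewrite /gen_cap big_cat.
- split => //.
  + split => //; have := approximable_cap [::].
    by rewrite /gen_cap big_nil.
  + move=> C D DC [mC aC] [mD aD]; split; first exact: measurableD.
    rewrite (_ : (fun _ => _) =
        fun z => \1_C (Z z) + ratr (-1) * \1_D (Z z)); last first.
      apply/funext => z; rewrite rmorphN1 mulN1r !indicE in_setD.
      have [ZD|ZD] := boolP (Z z \in D); last by rewrite andbT oppr0 addr0.
      by rewrite (_ : Z z \in C) ?subrr// inE; apply: DC; rewrite -inE.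
    by apply: approximableD => //; exact: approximableZ.
  + move=> F ndF aF; have mF i := (aF i).1.
    have mU : measurable (\bigcup_i F i) by exact: bigcup_measurable.
    split => //; apply: approximable_close => [|e e0]; first exact: mI.
    have mZF i : measurable (Z @^-1` F i).
      by rewrite -[X in measurable X]setTI; exact: mZ.
    have mZU : measurable (\bigcup_i (Z @^-1` F i)) by exact: bigcup_measurable.
    have cF : P (Z @^-1` F i) @[i --> \oo] --> P (\bigcup_i (Z @^-1` F i)).
      apply: nondecreasing_cvg_mu => // i j ij; apply/subsetPset => z.
      by apply: (subsetPset _ _ (ndF _ _ ij)).
    (* Continuity of [P] from below provides an [F n] that misses at most mass [e] of the union; the
       L1 distance between the two indicators is the missed mass. *)
    have [n Pn] : exists n,
        (P (\bigcup_i (Z @^-1` F i)) - e%:E <= P (Z @^-1` F n))%E.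
      apply: contrapT => /forallNP Pn.
      have : (P (\bigcup_i (Z @^-1` F i)) <= P (\bigcup_i (Z @^-1` F i)) - e%:E)%E.
        rewrite -{1}(cvg_lim _ cF)//; apply: lime_le; first exact: cvgP cF.
        by apply: nearW => n; rewrite leNgt; apply/negP => /ltW; exact: Pn.
      rewrite -[P _](fineK (fin_num_measure P _ mZU)) -EFinB lee_fin.
      by rewrite lerDl oppr_ge0 leNgt e0.
    exists (fun z => \1_(F n) (Z z)); first exact: (aF n).2.
    apply: (@le_trans _ _ (\int[P]_z
        (\1_(\bigcup_i (Z @^-1` F i) `\` Z @^-1` F n) z)%:E)%E).
      rewrite le_eqVlt; apply/orP; left; apply/eqP.
      apply: eq_integral => z _; rewrite !indicE in_setD.
      rewrite (_ : (z \in _) = (Z z \in \bigcup_i F i)); last first.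
        by apply/idP/idP; rewrite !inE.
      rewrite [in RHS](_ : (z \in _) = (Z z \in F n)); last first.
        by apply/idP/idP; rewrite !inE.
      have [ZF|ZF] := boolP (Z z \in F n).
        rewrite (_ : Z z \in \bigcup_i F i); first by rewrite subrr normr0.
        by rewrite inE; exists n => //; rewrite -inE.
      by rewrite subr0 andbT normr_nat.
    rewrite integral_indic//; last exact: measurableD.
    rewrite setIT measureD//; last by rewrite (le_lt_trans (probability_le1 P mZU))// ltry.
    rewrite setIidr; last by move=> z; exists n.
    rewrite leeBlDr; last exact: fin_num_measure.
    by rewrite addeC -leeBlDr.
- by move=> _ [s _ <-]; split; [exact: measurable_gen_cap|exact: approximable_cap].
Qed.

(** Rounding [h] down to a multiple of [N^-1] costs at most [N^-1]. The rounded function combines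
    indicators of superlevel sets of [h], which are preimages by [Z] of measurable sets. *)
Lemma approximable_preimage (h : TZ -> R) : measurable_fun setT h ->
  (forall z, 0 < h z < 1) -> approximable h.
Proof.
move=> mh h01; apply: approximable_close => [|e e0].
  exact: (measurable_fun_preimageW mZ mh).
pose N := (Num.truncn e^-1).+1.
have N0 : 0 < N%:R :> R by rewrite ltr0n.
have Ne : N%:R^-1 <= e.
  by rewrite invf_ple ?posrE//; exact/ltW/truncnS_gt.
(* The number [n] of thresholds varies while the scale [N] stays fixed, so that induction applies;
   the case [n = N] is the one used below. *)
have aS n : approximable
    (fun z => ratr (N%:R^-1) * \sum_(j < n) (j.+1%:R <= N%:R * h z)%R%:R).
  apply: approximableZ; elim: n => [|n IH].
    under eq_fun do rewrite big_ord0.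
    split => // a a0; exists [::]; under eq_integral => z _.
      rewrite /step_comb big_nil subrr normr0; over.
    by rewrite integral0 lee_fin ltW.
  under eq_fun do rewrite big_ord_recr/=.
  apply: approximableD => //.
  have [B mB BE] : measurable ([set z | n.+1%:R <= N%:R * h z] : set TZ).
    rewrite -[X in measurable X]setTI; apply: measurable_fun_ler => //.
    exact: measurable_funM.
  rewrite (_ : (fun _ => _) = fun z => \1_B (Z z)); first exact: approximable_indic.
  apply/funext => z; rewrite indicE; congr (nat_of_bool _)%:R.
  have := congr1 (fun A : set T => A z) BE; rewrite /= => BEz.
  apply/idP/idP; rewrite inE; rewrite -BEz; tauto.
exists (fun z => ratr (N%:R^-1) * \sum_(j < N) (j.+1%:R <= N%:R * h z)%R%:R) => //.
apply: (@le_trans _ _ (\int[P]_z e%:E)%E); last first.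
  by rewrite integral_cst// [X in (_ * X)%E](probability_setT P) mule1.
apply: (@ge0_le_integral _ T R P setT measurableT
  (fun z => `|h z - ratr N%:R^-1 * \sum_(j < N) (j.+1%:R <= N%:R * h z)%R%:R|%:E)
  (fun=> e%:E)) => //.
- apply: mdist; first exact: (measurable_fun_preimageW mZ mh).
  by case: (aS N).
move=> z _; rewrite lee_fin; apply: le_trans Ne.
have /andP[h0 h1] := h01 z.
have Nh0 : 0 <= N%:R * h z by rewrite mulr_ge0// ltW.
have NhN : N%:R * h z <= N%:R by rewrite ger_pMr// ltW.
have := count_steps_itv Nh0 NhN; set S := \sum_(j < N) _ => /andP[S1 S2].
have N_neq0 : N%:R != 0 :> R by rewrite gt_eqF.
rewrite fmorphV rmorph_nat -{1}[h z](mulKf N_neq0) -mulrBr normrM gtr0_norm ?invr_gt0//.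
by rewrite -[leRHS]mulr1 ler_pM2l ?invr_gt0// ger0_norm ?subr_ge0// lerBlDl.
Qed.

End step_comb.

(** * Countable generators for pairs of real tuples *)

Lemma measurable_rat_rayP d (T : measurableType d) (R : realType) (f : T -> R) :
  (forall a : rat, measurable [set z | ratr a < f z]) -> measurable_fun setT f.
Proof.
move=> mf; apply: (measurability _ (RGenOInfty.measurableE R)).
move=> _ [_ [x ->] <-]; rewrite setTI.
(* By density of the rationals, the open ray from [x] is the union of the open rays from the
   rationals that are at least [x]. *)
rewrite (_ : _ @^-1` _ =
    \bigcup_(a : rat) (if x <= ratr a then [set z | ratr a < f z] else set0)).
  by apply: bigcupT_measurable_rat => a; case: ifPn.
apply/seteqP; split => z /=; rewrite in_itv/= andbT.
  move=> /rat_in_itvoo[a]; rewrite inE /= => /itvP xaz.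
  by exists a => //=; rewrite xaz/= xaz.
by move=> [a _]; case: ifPn => // xa /=; exact: le_lt_trans.
Qed.

Section tuple_pair_generators.
Context {R : realType} {d : nat}.

Local Notation W := (d.-tuple R * d.-tuple R)%type.

Definition tuple_pair_ray (i : bool * 'I_d * rat) : set W :=
  [set w | ratr i.2 < tnth (if i.1.1 then w.1 else w.2) i.1.2].

Lemma measurable_tuple_pair_ray i : measurable (tuple_pair_ray i).
Proof.
rewrite -[X in measurable X]setTI; apply: measurable_fun_ltr => //.
case: i => [[b i] a] /=; apply: (measurableT_comp (measurable_tnth i)).
by case: b; [exact: measurable_fst|exact: measurable_snd].
Qed.

(** The inclusion says that the identity from [V] to [W] is measurable; this is checked on each
    coordinate, where rational rays suffice. *)
Lemma tuple_pair_rays_generate :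
  @measurable _ W `<=` <<s range tuple_pair_ray>>.
Proof.
pose V := g_sigma_algebraType (range tuple_pair_ray).
have mproj (b : bool) :
    measurable_fun [set: V] (fun w : V => if b then (w : W).1 else (w : W).2).
  apply/measurable_fun_tnthP => i; apply: measurable_rat_rayP => a.
  by apply: sub_sigma_algebra; exists (b, i, a).
have mid : measurable_fun [set: V] (fun w : V => (w : W)).
  by apply/measurable_fun_pairP; split; [exact: (mproj true)|exact: (mproj false)].
by move=> B /(mid measurableT); rewrite setTI.
Qed.

End tuple_pair_generators.

(** * Measurability in the prompt of the conditional entropy *)

Section measurable_cond_entropy.
Context {dX dY : measure_display} {X : measurableType dX}
  {Y : measurableType dY} {R : realType} (mu : R.-pker X ~> Y).
Context {I : countType} {dW : measure_display} {W : measurableType dW}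
  (G : I -> set W).
Hypotheses (mG : forall i, measurable (G i))
  (WG : @measurable _ W `<=` <<s range G>>).
Variable Z : X -> Y * Y -> W.
Hypothesis mZ : measurable_fun setT (fun p => Z p.1 p.2).
Variable f : X -> Y * Y -> R.
Hypotheses (mf : measurable_fun setT (fun p => f p.1 p.2))
  (f01 : forall x z, 0 < f x z < 1).
Variable h : X -> Y * Y -> R.
Hypotheses
  (mh : forall x,
    measurable_fun [set: g_sigma_algebra_preimageType (Z x)] (h x))
  (h01 : forall x z, 0 < h x z < 1)
  (hf : forall x (A : set (Y * Y)),
    measurable (A : set (g_sigma_algebra_preimageType (Z x))) ->
    (\int[pair_prob mu x]_(z in A) (h x z)%:E =
     \int[pair_prob mu x]_(z in A) (f x z)%:E)%E).

Let mZx x : measurable_fun setT (Z x).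
Proof. exact: (measurable_fun_pair2 x mZ). Qed.

Let mfx x : measurable_fun setT (f x).
Proof. exact: (measurable_fun_pair2 x mf). Qed.

Let mhx x : measurable_fun [set: Y * Y] (h x).
Proof. exact: (measurable_fun_preimageW (mZx x) (@mh x)). Qed.

(** The shift by 2 keeps the radius at most 1/2, as clipping requires. *)
Definition guess_radius (k : nat) : R := k.+2%:R^-1.

Lemma guess_radius_itv k : 0 < guess_radius k <= 2^-1.
Proof. by rewrite invr_gt0 ltr0n/= lef_pV2 ?posrE// ler_nat. Qed.

(* An enumeration of the countable family of predictors over which the cross
   entropy is minimised. *)
Definition guess (n : nat) (w : W) : R :=
  let kc : nat * seq (rat * seq I) := odflt (0%N, [::]) (unpickle n) in
  clip (guess_radius kc.1) (step_comb G kc.2 w).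

Lemma guess_itv n w : 0 < guess n w < 1.
Proof.
rewrite /guess; set kc := odflt _ _; have r2 := guess_radius_itv kc.1.
have /andP[rc cr] := clip_itv (step_comb G kc.2 w) r2.
by case/andP: r2 => *; apply/andP; split; lra.
Qed.

Lemma measurable_guess n : measurable_fun setT (guess n).
Proof. by apply: measurable_clip; exact: measurable_step_comb. Qed.

Definition guess_loss n x : \bar R :=
  (\int[pair_prob mu x]_z (cross_entropy (f x z) (guess n (Z x z)))%:E)%E.

Lemma measurable_guess_loss n : measurable_fun setT (guess_loss n).
Proof.
apply: (@measurable_pair_integral _ _ _ _ _ mu (fun p =>
  (cross_entropy (f p.1 p.2) (guess n (Z p.1 p.2)))%:E)).
  by move=> p; rewrite lee_fin cross_entropy_ge0// guess_itv.
apply/measurable_EFinP; apply: measurable_cross_entropy => //.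
exact: (measurableT_comp (measurable_guess n) mZ).
Qed.

Lemma guess_lossE n x : (guess_loss n x =
  \int[pair_prob mu x]_z (entropy (h x z))%:E +
  \int[pair_prob mu x]_z (kl_div (h x z) (guess n (Z x z)))%:E)%E.
Proof.
apply: (cond_cross_entropyE (Z := Z x)) => //.
- exact: hf.
- exact: (measurable_fun_preimage_comp (measurable_guess n)).
- by move=> z; exact: guess_itv.
Qed.

(** Clipping at radius [r] costs [2 * r], and the L1 error is multiplied by [2 / r]. The radius is
    therefore fixed first, with [2 * r <= e / 2], and then the L1 precision [e * r / 4] makes the
    other term at most [e / 2]. *)
Lemma kl_div_guess_le x e : 0 < e -> exists n,
  (\int[pair_prob mu x]_z (kl_div (h x z) (guess n (Z x z)))%:E <= e%:E)%E.
Proof.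
move=> e0; pose k := Num.truncn (4 / e); set r := guess_radius k.
have r_itv : 0 < r <= 2^-1 := guess_radius_itv k; have /andP[r0 r2] := r_itv.
have re : 2 * r <= e / 2.
  suff : r <= (4 / e)^-1 by rewrite invf_div => ?; lra.
  rewrite lef_pV2 ?posrE ?divr_gt0// (le_trans (ltW (truncnS_gt _)))//.
  by rewrite ler_nat.
have [_ ha] := approximable_preimage mG WG (pair_prob mu x) (mZx x) (@mh x) (h01 x).
have er0 : 0 < e * r / 4 by rewrite divr_gt0 ?mulr_gt0.
have [c hc] := ha _ er0.
exists (pickle (k, c)); rewrite /guess pickleK/= -/r.
have mc : measurable_fun setT (fun z => step_comb G c (Z x z) : R).
  exact: (measurableT_comp (measurable_step_comb mG c) (mZx x)).
have mdist : measurable_fun setT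
    (fun z => `|h x z - step_comb G c (Z x z)|%:E).
  apply/measurable_EFinP.
  apply: (measurableT_comp (@normr_measurable R setT)).
  exact: measurable_funB.
have r20 : 0 <= 2 / r by rewrite divr_ge0// ltW.
apply: (@le_trans _ _ (\int[pair_prob mu x]_z
    ((2 * r)%:E + (2 / r)%:E * `|h x z - step_comb G c (Z x z)|%:E))%E).
  apply: ge0_le_integral => //.
  - move=> z _; rewrite lee_fin kl_div_ge0//.
    have /andP[] := clip_itv (step_comb G c (Z x z)) r_itv.
    by move=> *; apply/andP; split; lra.
  - apply/measurable_EFinP; apply: measurable_kl_div => //.
    exact: measurable_clip.
  - apply: emeasurable_funD => //; exact: measurable_funeM.
  - move=> z _; rewrite -EFinM -EFinD lee_fin; exact: kl_div_clip_le.
rewrite ge0_integralD//; last 3 first.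
- by move=> z _; rewrite lee_fin mulr_ge0// ltW.
- by move=> z _; rewrite mule_ge0// lee_fin.
- exact: measurable_funeM.
rewrite integral_cst// [X in (_ * X)%E](probability_setT (pair_prob mu x)) mule1.
rewrite ge0_integralZl_EFin//.
rewrite [e in leRHS]splitr [leRHS]EFinD; apply: leeD; first by rewrite lee_fin.
apply: (@le_trans _ _ ((2 / r)%:E * (e * r / 4)%:E)%E).
  by rewrite lee_wpmul2l// lee_fin.
have cancel_r (s : R) : 0 < s -> 2 / s * (e * s / 4) = e / 2.
  by move=> s0; field; rewrite gt_eqF.
by rewrite -EFinM lee_fin cancel_r.
Qed.

(** The excess of each guess loss over the entropy of [h] is a divergence, nonnegative and
    arbitrarily small for suitable guesses. Taken from index 0, [einfs] is the infimum over all
    guesses. *)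
Lemma cond_entropy_einfs x :
  (\int[pair_prob mu x]_z (entropy (h x z))%:E)%E =
  einfs (guess_loss ^~ x) 0%N.
Proof.
apply/eqP; rewrite eq_le; apply/andP; split.
  apply: le_ereal_inf_tmp => _ [n _ <-]; rewrite guess_lossE leeDl//.
  by apply: integral_ge0 => z _; rewrite lee_fin kl_div_ge0// guess_itv.
apply/lee_addgt0Pr => e e0; have [n ne] := kl_div_guess_le x e0.
apply: (@le_trans _ _ (guess_loss n x)).
  by apply: ereal_inf_lbound; exists n.
by rewrite guess_lossE leeD2l.
Qed.

Lemma measurable_cond_entropy : measurable_fun setT
  (fun x => \int[pair_prob mu x]_z (entropy (h x z))%:E)%E.
Proof.
apply: (eq_measurable_fun (fun x => einfs (guess_loss ^~ x) 0%N)).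
  by move=> x _; rewrite cond_entropy_einfs.
by apply: measurable_fun_einfs => n; exact: measurable_guess_loss.
Qed.

End measurable_cond_entropy.

(** * Adding the identities over the prompts *)

Lemma ge0_integral_telescope d (X : measurableType d) (R : realType)
    (nu : probability X R) (c : R) (A V L E G : X -> \bar R) :
  measurable_fun setT A -> measurable_fun setT V -> measurable_fun setT L ->
  (forall x, (0 <= A x)%E) -> (forall x, (0 <= E x)%E) ->
  (forall x, (0 <= G x)%E) -> (forall x, (V x <= c%:E)%E) ->
  (forall x, V x = A x + E x)%E -> (forall x, L x = V x + G x)%E ->
  (\int[nu]_x L x - \int[nu]_x A x = \int[nu]_x E x + \int[nu]_x G x)%E.
Proof.
move=> mA mV mL A0 E0 G0 Vc VE LE.
have V0 x : (0 <= V x)%E by rewrite VE adde_ge0.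
have AV x : (A x <= V x)%E by rewrite VE leeDl.
(* The bound [c] makes [V], hence [A], finite, whereas [L] and [G] may be infinite. So [E] and [G]
   are the differences [V - A] and [L - V], from which they inherit measurability. *)
have Vfin x : V x \is a fin_num.
  by rewrite ge0_fin_numE// (le_lt_trans (Vc x))// ltry.
have Afin x : A x \is a fin_num.
  by rewrite ge0_fin_numE// (le_lt_trans (AV x))// -ge0_fin_numE.
have mE : measurable_fun setT E.
  rewrite (_ : E = V \- A)%E; first exact: emeasurable_funB.
  by apply/funext => x; rewrite /= VE addeAC subee// add0e.
have mG : measurable_fun setT G.
  rewrite (_ : G = L \- V)%E; first exact: emeasurable_funB.
  by apply/funext => x; rewrite /= LE addeAC subee// add0e.
(* This finiteness justifies the final cancellation; the integral of [L] may be infinite. *)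
have IA : (\int[nu]_x A x)%E \is a fin_num.
  rewrite ge0_fin_numE; last exact: integral_ge0.
  apply: (@le_lt_trans _ _ (\int[nu]_x c%:E)%E).
    apply: ge0_le_integral => // x _; exact: (le_trans (AV x) (Vc x)).
  by rewrite integral_cst// [X in (_ * X)%E](probability_setT nu) mule1 ltry.
under eq_integral do rewrite LE VE.
rewrite ge0_integralD//; last 2 first.
- by move=> x _; exact: adde_ge0.
- exact: emeasurable_funD.
rewrite ge0_integralD//.
by rewrite -[X in (X - _)%E]addeA addeAC subee// add0e.
Qed.

(** * Range and measurability of the pooled win probability *)

Section pooled_win_prob.
Context {dX dY : measure_display} {X : measurableType dX}
  {Y : measurableType dY} {R : realType} (n : nat) (u : 'I_n -> X * Y -> R).

Lemma pooled_win_prob_itv x y y' : (0 < n)%N ->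
  0 < pooled_win_prob u x y y' < 1.
Proof.
move=> n0; have n0' : 0 < n%:R :> R by rewrite ltr0n.
have hasI : has predT (index_enum 'I_n).
  by apply/hasP; exists (Ordinal n0); rewrite ?mem_index_enum.
rewrite /pooled_win_prob mulr_gt0 ?invr_gt0//=; last first.
  rewrite [ltLHS](_ : 0 = \sum_(i < n) (0 : R)); last by rewrite big1.
  by apply: ltr_sum => // i _; exact: logistic_gt0.
rewrite mulrC ltr_pdivrMr// mul1r -[ltRHS](_ : \sum_(i < n) (1 : R) = _); last first.
  by rewrite sumr_const card_ord.
by apply: ltr_sum => // i _; exact: logistic_lt1.
Qed.

Hypothesis mu_ : forall i, measurable_fun [set: X * Y] (u i).

Lemma measurable_pooled_win_prob :
  measurable_fun setT (fun p : X * (Y * Y) => pooled_win_prob u p.1 p.2.1 p.2.2).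
Proof.
apply: measurable_funM => //; apply: measurable_sum => i.
apply: measurable_logistic; apply: measurable_funB;
  apply: (measurableT_comp (mu_ i)); apply/measurable_fun_pair => //;
  exact: measurableT_comp.
Qed.

End pooled_win_prob.

Theorem proposition4p1 (R : realType) (dX dY : measure_display)
  (X : measurableType dX) (Y : measurableType dY)
  (nu : probability X R) (mu : R.-pker X ~> Y)
  (n : nat) (n_gt0 : (0 < n)%N)
  (u : 'I_n -> X * Y -> R)
  (measurable_u : forall i, measurable_fun [set: X * Y] (u i))
  (d : nat) (phi : X * Y -> d.-tuple R)
  (measurable_phi : measurable_fun [set: X * Y] phi)
  (g : d.-tuple R -> R) (measurable_g : measurable_fun [set: d.-tuple R] g)
  (r : X * Y -> R) (rE : forall x y, r (x, y) = g (phi (x, y)))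
  (ptilde : X -> Y -> Y -> R)
  (ptildeP : is_embedded_win_prob mu phi (pooled_win_prob u) ptilde) :
  (loss nu mu (pooled_win_prob u) r - bayes_loss nu mu (pooled_win_prob u) =
   embedding_error nu mu (pooled_win_prob u) ptilde +
   aggregation_error nu mu ptilde r)%E.
Proof.
pose f x (z : Y * Y) := pooled_win_prob u x z.1 z.2.
pose Z x (z : Y * Y) := (phi (x, z.1), phi (x, z.2)).
pose q x (z : Y * Y) := logistic (reward_diff r x z.1 z.2).
have f01 x z : 0 < f x z < 1 by exact: pooled_win_prob_itv.
have q01 x z : 0 < q x z < 1 by rewrite logistic_gt0 logistic_lt1.
have mf : measurable_fun setT (fun p : X * (Y * Y) => f p.1 p.2).
  exact: measurable_pooled_win_prob.
have mZ : measurable_fun setT (fun p : X * (Y * Y) => Z p.1 p.2).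
  by apply/measurable_fun_pair; apply: (measurableT_comp measurable_phi);
    apply/measurable_fun_pair => //; exact: measurableT_comp.
pose qW (w : d.-tuple R * d.-tuple R) := logistic (g w.1 - g w.2).
have mqW : measurable_fun setT qW.
  apply: measurable_logistic; apply: measurable_funB;
    exact: (measurableT_comp measurable_g).
(* Since [r] is [g] composed with [phi], the predicted probability factors through the embedded
   pair. *)
have qE x z : q x z = qW (Z x z) by rewrite /q /reward_diff !rE.
have mfx x : measurable_fun setT (f x) := measurable_fun_pair2 x mf.
have mZx x : measurable_fun setT (Z x) := measurable_fun_pair2 x mZ.
have mq : measurable_fun setT (fun p : X * (Y * Y) => q p.1 p.2).
  under eq_fun do rewrite qE; exact: (measurableT_comp mqW mZ).
have mqx x : measurable_fun setT (q x) := measurable_fun_pair2 x mq.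
have mqZ x : measurable_fun [set: g_sigma_algebra_preimageType (Z x)] (q x).
  rewrite (_ : q x = qW \o Z x); first exact: measurable_fun_preimage_comp.
  by apply/funext => z; exact: qE.
(* A version with values in ]0, 1[ is chosen for each prompt separately, so no joint measurability
   in the prompt comes with it. *)
pose hx x := cid (cond_exp_itv01 (P := pair_prob mu x)
  (mZx x) (mfx x) (f01 x) (ptildeP x)).
pose h x : Y * Y -> R := sval (hx x); have hP x := svalP (hx x).
have mh x : measurable_fun [set: g_sigma_algebra_preimageType (Z x)] (h x).
  by have [] := hP x.
have h01 x z : 0 < h x z < 1 by have [_ + _ _] := hP x; exact.
have hf x (A : set (Y * Y)) :
    measurable (A : set (g_sigma_algebra_preimageType (Z x))) ->
    (\int[pair_prob mu x]_(z in A) (h x z)%:E =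
     \int[pair_prob mu x]_(z in A) (f x z)%:E)%E.
  by have [_ _ + _] := hP x; exact.
have hpsi x (psi : Y * Y -> R -> R) :
    measurable_fun setT (fun p : (Y * Y) * R => psi p.1 p.2) ->
    (\int[pair_prob mu x]_z (psi z (ptilde x z.1 z.2))%:E =
     \int[pair_prob mu x]_z (psi z (h x z))%:E)%E.
  by have [_ _ _ +] := hP x; exact.
(* The later unification problems must not unfold the choice of [h]. *)
clear hP; clearbody h; clear hx.
(* The integrals of [L] and [A] are the loss and the Bayes loss. The difference telescopes through
   [V], the entropy of the conditional win probability: [E] is the gap from [A] to [V] and [G] the
   gap from [V] to [L]. *)
pose A x := (\int[pair_prob mu x]_z (entropy (f x z))%:E)%E.
pose V x := (\int[pair_prob mu x]_z (entropy (h x z))%:E)%E.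
pose L x := (\int[pair_prob mu x]_z (cross_entropy (f x z) (q x z))%:E)%E.
pose E x := (\int[pair_prob mu x]_z (kl_div (f x z) (h x z))%:E)%E.
pose G x := (\int[pair_prob mu x]_z (kl_div (h x z) (q x z))%:E)%E.
have embE : embedding_error nu mu (pooled_win_prob u) ptilde = (\int[nu]_x E x)%E.
  apply: eq_integral => x _; apply: (hpsi x (fun z t => kl_div (f x z) t)).
  apply: measurable_kl_div measurable_snd.
  exact: (measurableT_comp (mfx x) measurable_fst).
have aggE : aggregation_error nu mu ptilde r = (\int[nu]_x G x)%E.
  apply: eq_integral => x _; apply: (hpsi x (fun z t => kl_div t (q x z))).
  apply: (measurable_kl_div measurable_snd).
  exact: (measurableT_comp (mqx x) measurable_fst).
rewrite embE aggE.
apply: (@ge0_integral_telescope _ _ _ nu (ln 2) A V L E G).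
- apply: (@measurable_pair_integral _ _ _ _ _ mu
    (fun p => (entropy (f p.1 p.2))%:E)).
    by move=> p; rewrite lee_fin entropy_ge0.
  by apply/measurable_EFinP; exact: measurable_entropy.
- exact: (measurable_cond_entropy (@measurable_tuple_pair_ray R d)
    (@tuple_pair_rays_generate R d) mZ mf f01 mh h01 hf).
- apply: (@measurable_pair_integral _ _ _ _ _ mu
    (fun p => (cross_entropy (f p.1 p.2) (q p.1 p.2))%:E)).
    by move=> p; rewrite lee_fin cross_entropy_ge0.
  by apply/measurable_EFinP; exact: measurable_cross_entropy.
- by move=> x; apply: integral_ge0 => z _; rewrite lee_fin entropy_ge0.
- by move=> x; apply: integral_ge0 => z _; rewrite lee_fin kl_div_ge0.
- by move=> x; apply: integral_ge0 => z _; rewrite lee_fin kl_div_ge0.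
- move=> x; have mHh : measurable_fun setT (fun z => (entropy (h x z))%:E).
    apply/measurable_EFinP; apply: measurable_entropy.
    exact: (measurable_fun_preimageW (mZx x) (mh x)).
  rewrite -[leRHS]mule1 -(probability_setT (pair_prob mu x)).
  rewrite -[leRHS](integral_cst (pair_prob mu x) measurableT).
  apply: ge0_le_integral mHh _ _.
  + exact: measurableT.
  + by move=> z _; rewrite lee_fin entropy_ge0.
  + exact: measurable_cst.
  + by move=> z _; rewrite /= lee_fin entropy_le_ln2.
- by move=> x; exact: (cond_entropyE (mZx x) (mfx x) (f01 x) (mh x) (h01 x) (@hf x)).
- move=> x; exact: (cond_cross_entropyE (mZx x) (mfx x) (f01 x) (mh x) (h01 x)
    (@hf x) (mqZ x) (q01 x)).
Qed.
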